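(* Let $\mathcal{E}$ be a Euclidean vector space and $C$ a nonempty closed subset of $\mathcal{E}$. A point $x\in C$ is apocalyptic if and only if $C$ is not Clarke regular at $x$.
   Context: $\mathcal{E}$ is a finite-dimensional real inner product space. For a nonempty set $S$, $d(x,S)=\inf_{y\in S}\|x-y\|$ and $P_S(x)=\operatorname{argmin}_{y\in S}\|x-y\|$. For $x\in C$: the tangent cone $T_C(x)$ is the set of all $v$ for which there exist sequences $(x_i)$ in $C$ converging to $x$ and $(t_i)$ in $(0,\infty)$ with $(x_i-x)/t_i\to v$ (a closed cone); the regular normal cone is $\widehat N_C(x)=\{w\mid\langle v,w\rangle\le 0\ \forall v\in T_C(x)\}$; the normal cone $N_C(x)$ is the set of all $w$ for which there exist sequences $(x_i)$ in $C$ converging to $x$ and $(w_i)$ converging to $w$ with $w_i\in\widehat N_C(x_i)$ for all $i$. The closed set $C$ is Clarke regular at $x$ if $\widehat N_C(x)=N_C(x)$. For differentiable $\varphi:\mathcal{E}\to\mathbb{R}$ and $x\in C$, $\mathrm{s}(x;\varphi,C)$ is the common norm of all elements of $P_{T_C(x)}(-\nabla\varphi(x))$, i.e. $\mathrm{s}(x;\varphi,C)=\sqrt{\|\nabla\varphi(x)\|^2-d(-\nabla\varphi(x),T_C(x))^2}$. A point $x\in C$ is apocalyptic if there exist a sequence $(x_i)_{i\in\mathbb{N}}$ in $C$ converging to $x$ and a continuously differentiable function $\varphi:\mathcal{E}\to\mathbb{R}$ such that $\lim_{i\to\infty}\mathrm{s}(x_i;\varphi,C)=0$ whereas $\mathrm{s}(x;\varphi,C)>0$.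 *)

(* Defs.v *)
From HB Require Import structures.
From mathcomp Require Import all_boot all_order all_algebra sesquilinear.
From mathcomp Require Import ring lra.
From mathcomp Require Import all_classical all_reals all_analysis.

Set Implicit Arguments.
Unset Strict Implicit.
Unset Printing Implicit Defensive.

Import Order.TTheory GRing.Theory Num.Theory numFieldNormedType.Exports.

Local Open Scope classical_set_scope.
Local Open Scope ring_scope.

(* Being a [Vector] makes the space finite-dimensional; its norm, hence its
   topology, is the one induced by [inner]. *)
HB.mixin Record NormedVector_isEuclidean (R : realType) E
    of NormedModule R E & Vector R E := {
  inner : {dot E for (@idfun R)} ;
  sqr_norm_inner : forall x : E, `|x| ^+ 2 = inner x x
}.

#[short(type="euclideanType")]
HB.structure Definition Euclidean (R : realType) :=
  {E of NormedModule R E & Vector R E & NormedVector_isEuclidean R E}.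

Section definitions.
Context {R : realType} {E : euclideanType R}.
Implicit Types (C S : set E) (x v w : E) (phi : E -> R).

Definition dist x S : R := inf [set `|x - y| | y in S].

Definition proj S x : set E :=
  [set y | S y /\ forall z, S z -> `|x - y| <= `|x - z|].

Definition tangent_cone C x : set E :=
  [set v | exists (u : nat -> E) (t : nat -> R),
    [/\ forall i, C (u i),
        forall i, 0 < t i,
        u @ \oo --> x &
        (fun i => (t i)^-1 *: (u i - x)) @ \oo --> v]].

Definition regular_normal_cone C x : set E :=
  [set w | forall v, tangent_cone C x v -> inner v w <= 0].

Definition normal_cone C x : set E :=
  [set w | exists u_ w_ : nat -> E,
    [/\ forall i, C (u_ i),
        u_ @ \oo --> x,
        w_ @ \oo --> w &
        forall i, regular_normal_cone C (u_ i) (w_ i)]].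

Definition clarke_regular C x := regular_normal_cone C x = normal_cone C x.

(* The Riesz representative of the differential; see [gradP]. *)
Definition grad phi x : E :=
  xget 0 [set g | forall h, 'd (phi : E -> R^o) x h = inner g h].

Definition continuously_differentiable phi :=
  (forall x, differentiable (phi : E -> R^o) x) /\ continuous (grad phi).

(* The common norm of the projections of [- grad phi x] onto the tangent cone;
   see [norm_proj_tangent_cone]. *)
Definition stationarity phi C x : R :=
  Num.sqrt (`|grad phi x| ^+ 2 - dist (- grad phi x) (tangent_cone C x) ^+ 2).

Definition apocalyptic C x :=
  exists (u : nat -> E) (phi : E -> R),
    [/\ forall i, C (u i),
        u @ \oo --> x,
        continuously_differentiable phi,
        (fun i => stationarity phi C (u i)) @ \oo --> (0 : R) &
        0 < stationarity phi C x].

End definitions.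

Section properties.
Context {R : realType} {E : euclideanType R}.
Implicit Types (C : set E) (x p g h : E) (phi : E -> R).

Lemma innerC g h : inner g h = inner h g :> R.
Proof. by rewrite [LHS](@hermC R false idfun) expr0 mul1r. Qed.

Lemma riesz (f : {linear E -> R^o}) : exists g, forall h, f h = inner g h.
Proof.
pose n := \dim {:E}; pose b := vbasis {:E}.
have linF : linear (fun v : E => \row_(j < n) (inner v b`_j : R)).
  move=> a u v; apply/rowP => j; rewrite !mxE.
  by rewrite linearDl linearZl_LR.
pose F : {linear E -> 'rV[R]_n} := HB.pack
  (fun v : E => \row_(j < n) (inner v b`_j : R))
  (GRing.isLinear.Build _ _ _ _ _ linF).
pose L := linfun F.
have combE (k : {linear E -> R^o}) h :
    k h = \sum_(j < n) coord b j h * k b`_j.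
  rewrite {1}(coord_vbasis (memvf h)) linear_sum; apply: eq_bigr => j _.
  by rewrite linearZ.
have ker0 : lker L = 0%VS.
  apply/eqP; rewrite -subv0; apply/subvP => v; rewrite memv_ker lfunE /= memv0.
  move=> /eqP/rowP F0; suff: `|v| ^+ 2 == 0 by rewrite expf_eq0 normr_eq0.
  rewrite sqr_norm_inner (combE (inner v)) big1 // => j _.
  by have := F0 j; rewrite !mxE => F0j; rewrite [X in _ * X]F0j mulr0.
have full : limg L = fullv.
  apply/eqP; rewrite eqEdim subvf /=.
  have := limg_ker_dim L fullv; rewrite ker0 capv0 dimv0 add0n => ->.
  by rewrite dimvf /dim /= mul1n.
have /memv_imgP[g _ gE] : \row_j f b`_j \in limg L by rewrite full memvf.
exists g => h; rewrite (combE f) (combE (inner g)); apply: eq_bigr => j _.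
by congr (_ * _); have /rowP/(_ j) := gE; rewrite lfunE /= !mxE.
Qed.

Lemma gradP phi x h : 'd (phi : E -> R^o) x h = inner (grad phi x) h.
Proof.
rewrite /grad; case: xgetP => [g _ /(_ h)//|noG].
by have [g gP] := riesz ('d (phi : E -> R^o) x); case: (noG g).
Qed.

Lemma tangent_coneZ C x p (a : R) :
  0 < a -> tangent_cone C x p -> tangent_cone C x (a *: p).
Proof.
move=> a0 [u [t [Cu t0 ux up]]]; exists u, (fun i => a^-1 * t i); split=> //.
  by move=> i; rewrite mulr_gt0// invr_gt0.
under eq_fun do rewrite invfM invrK -scalerA.
exact: cvgZl_tmp.
Qed.

Lemma norm_proj_tangent_cone phi C x p :
  proj (tangent_cone C x) (- grad phi x) p -> `|p| = stationarity phi C x.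
Proof.
set T := tangent_cone C x; set g := - _ => -[Tp pmin].
have distE : dist g T = `|g - p|.
  apply/eqP; rewrite eq_le; apply/andP; split.
    apply: ge_inf; last by exists p.
    by exists 0 => _ [y _ <-].
  apply: lb_le_inf; first by exists `|g - p|, p.
  by move=> _ [y Ty <-]; apply: pmin.
have sqE (a : R) :
    `|g - a *: p| ^+ 2 = `|g| ^+ 2 - 2 * a * inner g p + a ^+ 2 * `|p| ^+ 2.
  have innerZr u v : inner u (a *: v) = a * inner u v by rewrite linearZ_LR.
  have innerZl u v : inner (a *: u) v = a * inner u v by rewrite linearZl_LR.
  rewrite !sqr_norm_inner linearBl !linearBr /= !innerZl !innerZr (innerC p g).
  ring.
have gpE : inner g p = `|p| ^+ 2.
  have minE (a : R) : 0 < a ->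
      - 2 * inner g p + `|p| ^+ 2 <= - 2 * a * inner g p + a ^+ 2 * `|p| ^+ 2.
    move=> a0; have := pmin _ (tangent_coneZ a0 Tp).
    rewrite -(@ler_pXn2r _ 2) ?nnegrE// sqE; have := sqE 1; rewrite scale1r => ->.
    lra.
  have [->|p0] := eqVneq p 0; first by rewrite linear0 normr0 expr0n.
  have N0 : 0 < `|p| ^+ 2 by rewrite exprn_gt0// normr_gt0.
  have [G0|G0] := ltP 0 (inner g p); last by have := minE 2^-1; lra.
  have := minE _ (divr_gt0 G0 N0); set a := _ / _ => aE.
  have GE : inner g p = a * `|p| ^+ 2 by rewrite divfK// gt_eqF.
  have : (a - 1) ^+ 2 * `|p| ^+ 2 <= 0 by move: aE; rewrite GE; lra.
  rewrite pmulr_lle0// => a1.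
  have /eqP : (a - 1) ^+ 2 == 0 by rewrite eq_le a1 sqr_ge0.
  by move/eqP; rewrite sqrf_eq0 subr_eq0 GE => /eqP ->; rewrite mul1r.
have gradE : `|grad phi x| = `|g| by rewrite normrN.
rewrite /stationarity gradE -/T -/g distE.
have := sqE 1; rewrite scale1r => ->; rewrite gpE.
rewrite [X in Num.sqrt X](_ : _ = `|p| ^+ 2); last by ring.
by rewrite sqrtr_sqr normr_id.
Qed.

End properties.

(* Main.v *)
(* s(x; phi, C) is the least e >= 0 with <- grad phi(x), v> <= e |v| for all v
   in T_C(x).

   If w is in N_C(x) but not in the regular normal cone, with w_i -> w regular
   normals at x_i -> x, then phi = - <w, .> witnesses that x is apocalyptic:
   s(x_i; phi, C) <= |w - w_i| since <w_i, v> <= 0 on T_C(x_i), whereas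
   <w, v> > 0 for some v in T_C(x).

   Conversely, let x be apocalyptic and g_i = - grad phi(x_i).  Since g_i is an
   s_i-approximate regular normal at x_i, projecting x_i + tau g_i on C for
   small tau gives a genuine regular normal w_i at a point z_i near x_i with
   |g_i - w_i| <= 2 s_i + 1/i.  Hence - grad phi(x) is in N_C(x), and it is not
   in the regular normal cone because s(x; phi, C) > 0. *)
Require Import Defs.
From mathcomp Require Import all_boot all_order all_algebra.
From mathcomp Require Import ring lra.
From mathcomp Require Import all_classical all_reals all_analysis.

Set Implicit Arguments.
Unset Strict Implicit.
Unset Printing Implicit Defensive.

Import Order.TTheory GRing.Theory Num.Theory numFieldNormedType.Exports.

Local Open Scope classical_set_scope.
Local Open Scope ring_scope.

(** * Inner product estimates, compactness and existence of projections *)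

Section inner_product.
Context {R : realType} {E : euclideanType R}.
Implicit Types (g h u v w : E) (a : R).

Lemma innerDr g u v : inner g (u + v) = inner g u + inner g v :> R.
Proof. by rewrite linearD. Qed.

Lemma innerNr g u : inner g (- u) = - inner g u :> R.
Proof. by rewrite linearN. Qed.

Lemma innerBr g u v : inner g (u - v) = inner g u - inner g v :> R.
Proof. by rewrite linearB. Qed.

Lemma innerBl g u v : inner (u - v) g = inner u g - inner v g :> R.
Proof. by rewrite !(innerC _ g) innerBr. Qed.

Lemma innerZr a g u : inner g (a *: u) = a * inner g u :> R.
Proof. by rewrite linearZ_LR. Qed.

Lemma innerZl a g u : inner (a *: u) g = a * inner u g :> R.
Proof. by rewrite !(innerC _ g) innerZr. Qed.

Lemma sqr_normB u v : `|u - v| ^+ 2 = `|u| ^+ 2 - 2 * inner u v + `|v| ^+ 2.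
Proof.
by rewrite !sqr_norm_inner innerBr !innerBl (innerC v u); ring.
Qed.

(** Cauchy-Schwarz comes from squaring the triangle inequality for [u - (- v)], as the norm is
    already known to be one. *)
Lemma inner_le u v : inner u v <= `|u| * `|v|.
Proof.
have : `|u - - v| ^+ 2 <= (`|u| + `|v|) ^+ 2.
  by rewrite ler_pXn2r ?nnegrE ?addr_ge0// -(normrN v) ler_normB.
by rewrite sqr_normB normrN innerNr; lra.
Qed.

Lemma norm_inner_le u v : `|inner u v| <= `|u| * `|v|.
Proof.
rewrite ler_norml inner_le andbT lerNl -innerNr.
by rewrite (le_trans (inner_le _ _))// normrN.
Qed.

Lemma inner_continuous g : continuous (fun v : E => inner g v : R^o).
Proof.
apply: (bounded_linear_continuous (f := inner g : {linear E -> R^o})).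
apply/bounded_funP => r; exists (`|g| * r) => v vr.
by rewrite (le_trans (norm_inner_le _ _))// ler_wpM2l.
Qed.

(** Heine-Borel by coordinates: [A] is a closed subset of the image of a compact box under the
    continuous map [f] that sums coordinates against the basis. *)
Lemma bounded_closed_compact_euclidean (A : set E) (M : R) :
  (forall v, A v -> `|v| <= M) -> closed A -> compact A.
Proof.
move=> AM Acl; pose b := vbasis {:E}.
pose f (r : 'rV[R]_(\dim {:E})) : E := \sum_j r 0 j *: b`_j.
(* Riesz vectors of the coordinate forms: by Cauchy-Schwarz, the [j]-th coordinate is at most [m j]
   in absolute value on [A]. *)
have /choice[c cE] (j : 'I_(\dim {:E})) :
    exists g, forall v, coord b j v = inner g v.
  exact: (riesz (coord b j : {linear E -> R^o})).
pose m j := `|c j| * M.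
have fK v : v = f (\row_j coord b j v).
  rewrite {1}(coord_vbasis (memvf v)) /f.
  by apply: eq_bigr => j _; rewrite mxE.
have fcont : continuous f.
  apply: continuous_big => [|j _ r].
    exact: add_continuous.
  apply: (@continuous_comp _ R E (fun r : 'rV_ _ => r 0 j) ( *:%R^~ b`_j)).
    exact: coord_continuous.
  exact: scalel_continuous.
have box : compact [set r : 'rV[R]_(\dim {:E}) |
    forall j, `[- m j, m j]%classic (r ord0 j)].
  apply: (@rV_compact _ _ (fun j => `[- m j, m j]%classic)) => j.
  exact: segment_compact.
apply: subclosed_compact Acl (continuous_compact _ box) _.
  exact: continuous_subspaceT.
move=> v /AM vM; exists (\row_j coord b j v); last exact/esym/fK.
move=> j /=; rewrite mxE in_itv/= -ler_norml cE.
by rewrite (le_trans (norm_inner_le _ _))// ler_wpM2l.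
Qed.

Lemma proj_nonempty (C : set E) (y : E) :
  C !=set0 -> closed C -> Defs.proj C y !=set0.
Proof.
move=> [x Cx] Ccl.
(* Points of [C] outside this ball are farther from [y] than [x] is, so a minimizer over the compact
   set [D] is one over [C]. *)
pose D := C `&` closed_ball_ Num.norm y `|y - x|.
have Dcompact : compact D.
  apply: (@bounded_closed_compact_euclidean _ (`|y| + `|y - x|)).
    move=> v [_ yv]; rewrite -[v](subKr y).
    by rewrite (le_trans (ler_normB _ _))// lerD2l.
  by apply: closedI => //; exact: closed_closed_ball_.
have Dx : D x by split; last exact: lexx.
have dist_cont : {within D, continuous (fun v => `|y - v|)}.
  apply: continuous_subspaceT => v.
  by apply: cvg_norm; apply: cvgB; [exact: cvg_cst|exact: cvg_id].
have [z zD zmin] := compact_EVT_min (ex_intro _ x Dx) Dcompact dist_cont.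
have [Cz _] := set_mem zD.
exists z; split=> //.
move=> v Cv; have [vx|/ltW vx] := leP `|y - v| `|y - x|.
  by apply: zmin; apply/mem_set; split.
exact: le_trans (zmin x (mem_set Dx)) vx.
Qed.

End inner_product.

(** * Convergence of sequences and subsequences *)

Lemma cvg_inv_succ {R : realType} (V : normedModType R) (f : nat -> V) (l : V) :
  (forall n, `|l - f n| <= n.+1%:R^-1) -> f @ \oo --> l.
Proof.
move=> fl; apply/cvgrPdist_le => e e0; near=> n.
rewrite (le_trans (fl n))//; near: n.
have /(@cvgr0Pnorm_lt R R^o)/(_ e e0) := @cvg_harmonic R.
by apply: filterS => n /ltW; exact/le_trans/ler_norm.
Unshelve. all: by end_near. Qed.

(** The indices are only asked to satisfy [n <= k n], which suffices to carry bounds in [n.+1%:R^-1]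
    over to the extracted sequence. *)
Lemma compact_cvg_subseq {R : realType} (V : normedModType R) (A : set V)
    (u : nat -> V) :
  compact A -> (forall n, A (u n)) ->
  exists2 l, A l & exists2 k : nat -> nat, forall n, (n <= k n)%N &
    (fun n => u (k n)) @ \oo --> l.
Proof.
move=> Acompact Au; have uA : (u @ \oo) A by exists 0%N => // n _; exact: Au.
have [l [Al ul]] := Acompact (u @ \oo) _ uA.
have /choice[k kP] : forall n, exists k, (n <= k)%N /\ `|l - u k| <= n.+1%:R^-1.
  move=> n; have := ul (u @` [set k | (n <= k)%N]) (ball l n.+1%:R^-1).
  case.
  - by exists n => // k nk; exists k.
  - by apply: nbhsx_ballx; rewrite invr_gt0.
  - move=> _ [[k nk <-]]; rewrite -ball_normE => /ltW lk.
    by exists k.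
exists l => //; exists k; first by move=> n; case: (kP n).
by apply: cvg_inv_succ => n; case: (kP n).
Qed.

(** * Tangent cones and construction of regular normals *)

Section cones.
Context {R : realType} {E : euclideanType R}.
Implicit Types (C : set E) (x y z g v w : E) (e : R).

Lemma tangent_cone0 C x : C x -> tangent_cone C x 0.
Proof.
move=> Cx; exists (fun=> x), (fun=> 1); split=> //; first exact: cvg_cst.
by under eq_fun do rewrite subrr scaler0; exact: cvg_cst.
Qed.

Lemma regular_normal_coneZ C x a w : 0 <= a ->
  regular_normal_cone C x w -> regular_normal_cone C x (a *: w).
Proof. by move=> a0 Nw v Tv; rewrite innerZr mulr_ge0_le0// Nw. Qed.

Lemma regular_normal_cone_sub C x : C x ->
  regular_normal_cone C x `<=` normal_cone C x.
Proof.
by move=> Cx w Nw; exists (fun=> x), (fun=> w); split=> //; exact: cvg_cst.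
Qed.

(** Minimality of [z] against [u i] gives [2 * inner (y - z) (u i - z) <= |u i - z| ^ 2]. After
    division by [t i] the right side tends to [0]. *)
Lemma proj_regular_normal C y z :
  Defs.proj C y z -> regular_normal_cone C z (y - z).
Proof.
move=> [Cz zmin] v [u [t [Cu t0 uz uv]]].
have vn : (fun i => inner (y - z) ((t i)^-1 *: (u i - z)) : R^o) @ \oo -->
    (inner (y - z) v : R^o).
  exact: (continuous_cvg _ (@inner_continuous _ _ (y - z) v) uv).
have vr : (fun i => 2^-1 * (`|u i - z| * `|(t i)^-1 *: (u i - z)|)) @ \oo -->
    2^-1 * (`|z - z| * `|v|).
  apply: cvgMl_tmp; apply: cvgM; apply: cvg_norm => //.
  by apply: cvgB => //; exact: cvg_cst.
rewrite innerC; move: vr; rewrite subrr normr0 mul0r mulr0 => vr.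
apply: (ler_cvg_to vn vr); near=> i.
rewrite normrZ innerZr gtr0_norm ?invr_gt0// !mulrA -(mulrA 2^-1).
rewrite (mulrC _ (t i)^-1) mulrA (mulrC 2^-1) -!mulrA.
rewrite ler_wpM2l ?invr_ge0 ?(ltW (t0 i))//.
have : `|y - z| ^+ 2 <= `|(y - z) - (u i - z)| ^+ 2.
  by rewrite opprB addrA subrK ler_pXn2r ?nnegrE// zmin.
by rewrite (sqr_normB (y - z)); lra.
Unshelve. all: by end_near. Qed.

(** Otherwise points violating the bound converge to [x], and their normalized differences
    accumulate, by compactness of the unit sphere, at a unit tangent [l] with
    [e' <= inner g l <= e]. *)
Lemma tangent_cone_near C x g e e' : e < e' ->
  (forall v, tangent_cone C x v -> inner g v <= e * `|v|) ->
  \forall z \near x, C z -> inner g (z - x) <= e' * `|z - x|.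
Proof.
move=> ee' gT; apply: contrapT => notnear.
have /choice[u uP] : forall n : nat, exists z,
    [/\ C z, `|x - z| <= n.+1%:R^-1 & e' * `|z - x| < inner g (z - x)].
  move=> n; apply: contrapT => noz; apply: notnear.
  have n0 : 0 < n.+1%:R^-1 :> R by rewrite invr_gt0.
  apply: filterS (nbhsx_ballx x _ n0) => z; rewrite -ball_normE => /ltW xz Cz.
  by rewrite leNgt; apply/negP => ?; apply: noz; exists z.
pose d n := `|u n - x|; pose v n := (d n)^-1 *: (u n - x).
have d0 n : 0 < d n.
  rewrite normr_gt0; apply/eqP => uE; have [_ _] := uP n.
  by rewrite uE normr0 mulr0 linear0 ltxx.
have v1 n : `|v n| = 1.
  have dn := d0 n; rewrite /v normrZ gtr0_norm ?invr_gt0//.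
  by rewrite mulVf// gt_eqF.
have sphere : compact [set w : E | `|w| = 1].
  apply: (@bounded_closed_compact_euclidean _ _ _ 1) => [w ->//|].
  apply: (@closed_comp _ _ (@Num.norm R E) [set 1]); last exact: closed_eq.
  by move=> w _; exact: norm_continuous.
have [l l1 [k kn vl]] := compact_cvg_subseq sphere v1.
have Tl : tangent_cone C x l.
  exists (u \o k), (d \o k); split=> //= [n|].
    by case: (uP (k n)).
  apply: cvg_inv_succ => n /=; have [_ xu _] := uP (k n).
  by rewrite (le_trans xu)// lef_pV2 ?posrE// ler_nat ltnS.
suff : e' <= e.
  by rewrite leNgt ee'.
rewrite -[e]mulr1 -[X in _ <= _ * X]l1; apply: le_trans (gT _ Tl).
have gl : (fun i => inner g (v (k i)) : R^o) @ \oo --> (inner g l : R^o).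
  exact: (continuous_cvg _ (@inner_continuous _ _ g l) vl).
apply: (ler_cvg_to (cvg_cst e') gl); near=> i.
rewrite innerZr mulrC ler_pdivlMr; last exact: d0.
by rewrite ltW//; case: (uP (k i)).
Unshelve. all: by end_near. Qed.

(* The tangent cone need not be convex, so [g] may be far from the regular
   normal cone at [x] itself; the regular normal is the proximal normal
   [(x + tau *: g - z) / tau] at a projection [z] of [x + tau *: g] on [C]. *)
Lemma regular_normal_approx C x g e eta :
  closed C -> C x -> 0 <= e -> 0 < eta ->
  (forall v, tangent_cone C x v -> inner g v <= e * `|v|) ->
  exists z w, [/\ C z, `|x - z| <= eta, regular_normal_cone C z w &
    `|g - w| <= 2 * e + eta].
Proof.
move=> Ccl Cx e0 eta0 gT.
have ee' : e < e + eta / 2 by rewrite ltrDl divr_gt0.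
have /nbhs_normP[r r0 /= near_x] := tangent_cone_near ee' gT.
(* Half of [r] keeps [z] strictly inside the ball where [near_x] applies. *)
pose s := Num.min eta (r / 2).
have s0 : 0 < s by rewrite lt_min eta0 divr_gt0.
(* This step length makes [2 * tau * `|g| <= s], which keeps [z] within [s] of
   [x]. *)
pose tau := s / (2 * (`|g| + 1)).
have g1 : 0 < `|g| + 1 by rewrite ltr_wpDl.
have tau0 : 0 < tau by rewrite divr_gt0// mulr_gt0.
have [z yz] := @proj_nonempty _ _ C (x + tau *: g) (ex_intro _ x Cx) Ccl.
have [Cz zmin] := yz.
(* [z] is at least as close to [x + tau *: g] as [x] is; expand the squares. *)
have sqE : `|z - x| ^+ 2 <= 2 * tau * inner g (z - x).
  have : `|tau *: g - (z - x)| ^+ 2 <= `|tau *: g| ^+ 2.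
    rewrite ler_pXn2r ?nnegrE//.
    rewrite opprB addrCA addrA; have := zmin _ Cx.
    by rewrite [X in _ <= `|X|]addrAC subrr add0r.
  by rewrite (sqr_normB (tau *: g)) innerZl; lra.
(* Used twice: with [c = |g|] to localize [z], then with [c = e + eta / 2], available once [z] is
   near [x], to get the final error [2 * c]. *)
have zx_le c : inner g (z - x) <= c * `|z - x| -> 0 <= c ->
    `|z - x| <= 2 * tau * c.
  move=> gc c0; have [->|zx] := eqVneq `|z - x| 0.
    by rewrite !mulr_ge0// ltW.
  have zx0 : 0 < `|z - x| by rewrite lt_neqAle eq_sym zx normr_ge0.
  rewrite -(ler_pM2r zx0) -expr2 (le_trans sqE)// -[leRHS]mulrA ler_wpM2l//.
  by rewrite mulr_ge0// ltW.
have zxs : `|z - x| <= s.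
  rewrite (le_trans (zx_le `|g| (inner_le _ _) (normr_ge0 _)))//.
  have -> : 2 * tau * `|g| = s * (`|g| / (`|g| + 1)).
    by rewrite /tau; field; rewrite gt_eqF.
  by rewrite ger_pMr// ler_pdivrMr// mul1r lerDl.
exists z, (tau^-1 *: (x + tau *: g - z)); split=> //.
- by rewrite distrC (le_trans zxs)// ge_min lexx.
- apply: regular_normal_coneZ; first by rewrite invr_ge0 ltW.
  exact: proj_regular_normal.
have -> : g - tau^-1 *: (x + tau *: g - z) = tau^-1 *: (z - x).
  rewrite addrAC scalerDr scalerA mulVf ?gt_eqF// scale1r opprD addrCA subrr.
  by rewrite addr0 -scalerN opprB.
rewrite normrZ gtr0_norm ?invr_gt0// mulrC ler_pdivrMr//.
have xz : inner g (z - x) <= (e + eta / 2) * `|z - x|.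
  apply: near_x => //=; rewrite distrC (le_lt_trans zxs)//.
  by rewrite gt_min ltr_pdivrMr// ltr_pMr// ltr1n orbT.
have ee'0 : 0 <= e + eta / 2 by rewrite (le_trans e0) ?ltW.
by have := zx_le _ xz ee'0; lra.
Qed.

End cones.

(** * The stationarity measure as a bound on tangent directions *)

Section stationarity.
Context {R : realType} {E : euclideanType R}.
Implicit Types (C : set E) (phi : E -> R) (x v g w : E).

Lemma dist_ge0 x (S : set E) : 0 <= dist x S.
Proof.
have [->|/set0P[y Sy]] := eqVneq S set0; first by rewrite /dist image_set0 inf0.
apply: lb_le_inf; first by exists `|x - y|, y.
by move=> _ [z _ <-]; exact: normr_ge0.
Qed.

Lemma dist_le x y (S : set E) : S y -> dist x S <= `|x - y|.
Proof.
move=> Sy; apply: ge_inf; last by exists y.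
by exists 0 => _ [z _ <-]; exact: normr_ge0.
Qed.

Lemma inner_le_stationarity phi C x v : tangent_cone C x v ->
  inner (- grad phi x) v <= stationarity phi C x * `|v|.
Proof.
rewrite /stationarity -(normrN (grad phi x)); set g := - _ => Tv.
have [gv|gv] := leP (inner g v) 0.
  by rewrite (le_trans gv)// mulr_ge0// sqrtr_ge0.
have v0 : 0 < `|v|.
  by rewrite normr_gt0; apply: contraTneq gv => ->; rewrite linear0 ltxx.
(* [a *: v] is the point of the ray through [v] nearest to [g]; it is tangent because [a] is
   positive. *)
pose a := inner g v / `|v| ^+ 2.
have dle : dist g (tangent_cone C x) ^+ 2 <= `|g - a *: v| ^+ 2.
  rewrite ler_pXn2r ?nnegrE ?dist_ge0//; apply/dist_le/tangent_coneZ => //.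
  by rewrite divr_gt0// exprn_gt0.
rewrite sqr_normB innerZr normrZ exprMn real_normK ?num_real// in dle.
have aE : (inner g v / `|v|) ^+ 2 = 2 * (a * inner g v) - a ^+ 2 * `|v| ^+ 2.
  by rewrite /a; field; rewrite gt_eqF.
have ge0 : 0 <= inner g v / `|v| by rewrite divr_ge0// ltW.
rewrite -ler_pdivrMr// -[leLHS]ger0_norm// -sqrtr_sqr ler_wsqrtr// aE.
by move: dle; lra.
Qed.

(** For tangent [v], [|g - v| ^ 2 >= |g| ^ 2 - 2 * e * |v| + |v| ^ 2 >= |g| ^ 2 - e ^ 2], the last
    step by [(|v| - e) ^ 2 >= 0]. *)
Lemma stationarity_le phi C x e : C x -> 0 <= e ->
  (forall v, tangent_cone C x v -> inner (- grad phi x) v <= e * `|v|) ->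
  stationarity phi C x <= e.
Proof.
move=> Cx e0; rewrite /stationarity -(normrN (grad phi x)); set g := - _ => gT.
rewrite -[leRHS](ger0_norm e0) -sqrtr_sqr ler_wsqrtr// lerBlDl -lerBlDr.
have [ge|/ltW eg] := leP `|g| e.
  apply: (@le_trans _ _ 0); last exact: sqr_ge0.
  by rewrite subr_le0 ler_pXn2r ?nnegrE.
have ge0 : 0 <= `|g| ^+ 2 - e ^+ 2 by rewrite subr_ge0 ler_pXn2r ?nnegrE.
rewrite -(sqr_sqrtr ge0) ler_pXn2r ?nnegrE ?sqrtr_ge0 ?dist_ge0//.
apply: lb_le_inf; first by exists `|g - 0|, 0 => //; exact: tangent_cone0.
move=> _ [v Tv <-]; rewrite -[leRHS]ger0_norm// -sqrtr_sqr ler_wsqrtr//.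
rewrite sqr_normB; have := gT _ Tv; have := sqr_ge0 (`|v| - e).
by rewrite sqrrB; lra.
Qed.

Lemma continuously_differentiable_inner w : let phi v := - inner w v : R in
  continuously_differentiable phi /\ forall x, - grad phi x = w.
Proof.
pose phi : {linear E -> R^o} := inner (- w).
have phiE : (fun v => - inner w v : R) = phi.
  by apply/funext => v; rewrite innerC -innerNr innerC.
rewrite phiE => /=.
have phic : continuous phi by exact: inner_continuous.
(* [gradP] only gives inner products with the gradient, so the difference is tested against
   itself. *)
have gradE x : grad phi x = - w.
  apply/eqP; rewrite -subr_eq0 -normr_eq0 -sqrf_eq0 sqr_norm_inner.
  by rewrite innerBl -gradP diff_lin// subrr.
split; last by move=> x; rewrite gradE opprK.
split; first by move=> x; exact: linear_differentiable.
have -> : grad phi = cst (- w) by apply/funext.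
exact: cst_continuous.
Qed.

End stationarity.

(** * Apocalyptic points and normals that are not regular *)

Section apocalyptic_points.
Context {R : realType} {E : euclideanType R}.
Implicit Types (C : set E) (x : E).

Lemma apocalyptic_normal C x : closed C -> C x -> apocalyptic C x ->
  exists2 w, normal_cone C x w & ~ regular_normal_cone C x w.
Proof.
move=> Ccl Cx [u [phi [Cu ux [_ phic] s0 sx]]].
exists (- grad phi x); last first.
  (* A regular normal satisfies the hypothesis of [stationarity_le] with [e = 0], against
     [0 < stationarity phi C x]. *)
  move=> Ng; move: sx; apply/negP; rewrite -leNgt.
  by apply: stationarity_le => // v Tv; rewrite mul0r innerC Ng.
have /choice[z zP] n : exists zw : E * E, [/\ C zw.1,
    `|u n - zw.1| <= n.+1%:R^-1, regular_normal_cone C zw.1 zw.2 &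
    `|- grad phi (u n) - zw.2| <= 2 * stationarity phi C (u n) + n.+1%:R^-1].
  have [|||z [w zw]] := @regular_normal_approx _ _ C (u n) (- grad phi (u n))
    (stationarity phi C (u n)) n.+1%:R^-1 Ccl (Cu n).
  - exact: sqrtr_ge0.
  - by rewrite invr_gt0.
  - by move=> v; exact: inner_le_stationarity.
  by exists (z, w).
have h0 : (fun n : nat => n.+1%:R^-1 : R) @ \oo --> 0 by exact: cvg_harmonic.
exists (fst \o z), (snd \o z); split => [n||| n]; try by case: (zP n).
(* Each sequence is written as a convergent one minus an error tending to [0]. *)
- rewrite (_ : fst \o z = fun n => u n - (u n - (z n).1)); last first.
    by apply/funext => n; rewrite subKr.
  rewrite -[x]subr0; apply: cvgB => //; apply: cvg_inv_succ => n.
  by rewrite sub0r normrN; case: (zP n).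
- rewrite (_ : snd \o z = fun n =>
      - grad phi (u n) - (- grad phi (u n) - (z n).2)); last first.
    by apply/funext => n; rewrite subKr.
  rewrite -[X in _ --> X]subr0; apply: cvgB.
    by apply: cvgN; exact: (continuous_cvg _ (phic x) ux).
  apply/norm_cvg0P.
  have bound0 : (fun n => 2 * stationarity phi C (u n) + n.+1%:R^-1) @ \oo -->
      (0 : R).
    rewrite -[X in _ --> X]addr0 -[X in X + _](mulr0 2).
    by apply: cvgD => //; exact: cvgMl_tmp.
  apply: (squeeze_cvgr _ (cvg_cst 0) bound0).
  by apply: nearW => n; rewrite normr_ge0/=; case: (zP n).
Qed.

Lemma normal_apocalyptic C x w : C x -> normal_cone C x w ->
  ~ regular_normal_cone C x w -> apocalyptic C x.
Proof.
move=> Cx [u [w_ [Cu ux ww Nw]]] nNw.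
have [phiC gradE] := continuously_differentiable_inner w.
exists u, (fun v => - inner w v); split => //; last first.
  (* Zero stationarity at [x] would make [w] a regular normal. *)
  rewrite lt_def sqrtr_ge0 andbT; apply/eqP => s0; apply: nNw => v Tv.
  have := inner_le_stationarity (fun v => - inner w v) Tv.
  by rewrite s0 mul0r gradE innerC.
have bound0 : (fun n => `|w - w_ n|) @ \oo --> (0 : R).
  apply/norm_cvg0P; rewrite -[X in _ --> X](subrr w).
  by apply: cvgB => //; exact: cvg_cst.
apply: (squeeze_cvgr _ (cvg_cst 0) bound0); apply: nearW => n.
rewrite sqrtr_ge0/=; apply: stationarity_le => // v Tv.
rewrite gradE -[w in inner w v](subrK (w_ n)) innerC innerDr !(innerC v).
by rewrite -[leRHS]addr0 lerD ?inner_le// innerC Nw.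
Qed.

End apocalyptic_points.

Theorem corollary2p11 (R : realType) (E : euclideanType R) (C : set E)
    (C_neq0 : C !=set0) (C_closed : closed C) (x : E) (Cx : C x) :
  apocalyptic C x <-> ~ clarke_regular C x.
Proof.
split=> [/(apocalyptic_normal C_closed Cx)[w Nw nNw] reg|nreg].
  by apply: nNw; rewrite reg.
apply: contrapT => napo; apply: nreg; apply/seteqP; split.
  exact: regular_normal_cone_sub.
by move=> w Nw; apply: contrapT => /(normal_apocalyptic Cx Nw).
Qed.
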